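(* Let $B\neq D$ be given points in the plane and let $\theta_1,\theta_2$ be given acute angles. Choose points $A$ and $C$ in the plane such that $ABCD$ is a convex quadrilateral with $\angle DAB=\theta_1$, $\angle DCB=\theta_2$, and such that $|AC|$ is as large as possible subject to these conditions. Then this determines a unique quadrilateral $ABCD$, up to congruence, and this quadrilateral has the property that $|AB|=|AD|$ and $|CB|=|CD|$.
   Context: A quadrilateral $ABCD$ is given by its four distinct vertices in the plane in cyclic order; angles are ordinary (unsigned) planar angles. *)

(* Defs.v *)
From Stdlib Require Import Reals List.
Import ListNotations.
Open Scope R_scope.

Definition point : Type := (R * R)%type.

Definition distance (P Q : point) : R :=
  dist_euc (fst P) (snd P) (fst Q) (snd Q).

(* Unsigned angle PQS at the vertex Q, in [0, PI]; meaningful only when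
   P <> Q and S <> Q. *)
Definition angle (P Q S : point) : R :=
  acos (((fst P - fst Q) * (fst S - fst Q) + (snd P - snd Q) * (snd S - snd Q))
        / (distance P Q * distance S Q)).

Definition acute (t : R) : Prop := 0 < t < PI / 2.

(* Twice the signed area of the triangle PQX; its sign tells on which side of
   the line PQ the point X lies. *)
Definition orient (P Q X : point) : R :=
  (fst Q - fst P) * (snd X - snd P) - (snd Q - snd P) * (fst X - fst P).

(* X and Y lie in the same open half-plane bounded by the line PQ. *)
Definition same_side (P Q X Y : point) : Prop :=
  0 < orient P Q X * orient P Q Y.

Definition quadrilateral (A B C D : point) : Prop := NoDup [A; B; C; D].

(* For each side, the two remaining vertices lie on the same side of its line. *)
Definition convex_quadrilateral (A B C D : point) : Prop :=
  quadrilateral A B C D /\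
  same_side A B C D /\ same_side B C D A /\
  same_side C D A B /\ same_side D A B C.

Definition isometry (f : point -> point) : Prop :=
  forall P Q : point, distance (f P) (f Q) = distance P Q.

Definition congruent (A B C D A' B' C' D' : point) : Prop :=
  exists f : point -> point,
    isometry f /\ f A = A' /\ f B = B' /\ f C = C' /\ f D = D'.

Definition admissible (B D : point) (t1 t2 : R) (A C : point) : Prop :=
  convex_quadrilateral A B C D /\ angle D A B = t1 /\ angle D C B = t2.

Definition optimal (B D : point) (t1 t2 : R) (A C : point) : Prop :=
  admissible B D t1 t2 A C /\
  forall A' C' : point, admissible B D t1 t2 A' C' -> distance A' C' <= distance A C.

(* Main.v *)
Require Import Defs.
From Stdlib Require Import Reals Lra.
Open Scope R_scope.

(** In the frame centred at the midpoint of [BD], with unit length [|BD|/2],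
    the vertex [A] runs over an arc of the circle with centre [(0, cot theta1)]
    and radius [1 / sin theta1], and [C] over the mirror image of the analogous
    arc for [theta2], on the other side of [BD].  The triangle inequality along
    the path from [A] to [C] through the two centres bounds [|AC|]; since the
    angles are acute the centres are distinct, so equality forces [A] and [C]
    onto the line of centres, the perpendicular bisector of [BD].  This leaves
    two configurations, exchanged by the reflection in [BD]. *)

(** With points read as complex numbers, this is the midpoint of [BD] plus [(x + iy) * (D - B) / 2].
    For [B <> D] it is a direct similarity, so squared distances and [orient] scale by the same
    factor. *)
Definition frame (B D : point) (x y : R) : point :=
  ((fst B + fst D) / 2 + x * ((fst D - fst B) / 2) - y * ((snd D - snd B) / 2),
   (snd B + snd D) / 2 + x * ((snd D - snd B) / 2) + y * ((fst D - fst B) / 2)).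

Definition cot (t : R) : R := cos t / sin t.

(** Height of the centre plus radius: for acute [t], the ordinate of the point of the circle
    farthest from [BD]. *)
Definition apex (t : R) : R := cot t + / sin t.

(** * Euclidean distance *)

Lemma distance_sqr (P Q : point) :
  (distance P Q)² = (fst P - fst Q)² + (snd P - snd Q)².
Proof.
  unfold distance, dist_euc. apply Rsqr_sqrt.
  apply Rplus_le_le_0_compat; apply Rle_0_sqr.
Qed.

Lemma distance_nonneg (P Q : point) : 0 <= distance P Q.
Proof. apply sqrt_pos. Qed.

Lemma distance_comm (P Q : point) : distance P Q = distance Q P.
Proof. apply Rgeom.distance_symm. Qed.

Lemma distance_pos (P Q : point) : P <> Q -> 0 < distance P Q.
Proof.
  intros H. destruct (distance_nonneg P Q) as [Hlt | Heq]; [exact Hlt |].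
  exfalso; apply H.
  pose proof (distance_sqr P Q) as E. rewrite <- Heq in E.
  rewrite Rsqr_0 in E. apply eq_sym, Rplus_sqr_eq_0 in E as [E1 E2].
  destruct P, Q; simpl in *; f_equal; lra.
Qed.

Lemma distance_eq (P Q P' Q' : point) :
  (distance P Q)² = (distance P' Q')² -> distance P Q = distance P' Q'.
Proof. apply Rsqr_inj; apply distance_nonneg. Qed.

Lemma half_distance_sqr_pos (B D : point) : B <> D -> 0 < (distance B D / 2)².
Proof. intros H. apply Rlt_0_sqr. pose proof (distance_pos B D H); lra. Qed.

(** * Coordinates and orientation relative to [BD] *)

Lemma frame_left (B D : point) : frame B D (-1) 0 = B.
Proof. destruct B, D; unfold frame; simpl; f_equal; field. Qed.

Lemma frame_right (B D : point) : frame B D 1 0 = D.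
Proof. destruct B, D; unfold frame; simpl; f_equal; field. Qed.

Lemma frame_surj (B D P : point) :
  B <> D -> exists x y, P = frame B D x y.
Proof.
  intros H. pose proof (half_distance_sqr_pos B D H) as Hd.
  rewrite Rsqr_div', distance_sqr in Hd.
  destruct B as [b1 b2], D as [d1 d2], P as [p1 p2]; unfold Rsqr in Hd; simpl in Hd.
  set (n := (b1 - d1) * (b1 - d1) + (b2 - d2) * (b2 - d2)) in Hd.
  assert (Hn : n <> 0) by lra.
  (* Real and imaginary parts of the complex quotient of [P] minus the midpoint by [(D - B) / 2]. *)
  exists (2 * ((p1 - (b1 + d1) / 2) * (d1 - b1) + (p2 - (b2 + d2) / 2) * (d2 - b2)) / n).
  exists (2 * ((p2 - (b2 + d2) / 2) * (d1 - b1) - (p1 - (b1 + d1) / 2) * (d2 - b2)) / n).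
  unfold frame; simpl; f_equal; unfold n in *; field; lra.
Qed.

Lemma distance_frame_sqr (B D : point) (x y x' y' : R) :
  (distance (frame B D x y) (frame B D x' y'))²
  = (distance B D / 2)² * ((x - x')² + (y - y')²).
Proof.
  rewrite Rsqr_div', !distance_sqr. unfold frame, Rsqr; simpl. field.
Qed.

Lemma frame_inj (B D : point) (x y x' y' : R) :
  B <> D -> frame B D x y = frame B D x' y' -> x = x' /\ y = y'.
Proof.
  intros H E. pose proof (half_distance_sqr_pos B D H) as Hd.
  pose proof (distance_frame_sqr B D x y x' y') as F.
  rewrite E, distance_sqr, !Rminus_diag, Rsqr_0, Rplus_0_r in F.
  apply eq_sym, Rmult_integral in F as [F | F]; [lra |].
  apply Rplus_sqr_eq_0 in F as [F1 F2]. lra.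
Qed.

Lemma distance_left_frame_sqr (B D : point) (x y : R) :
  (distance B (frame B D x y))² = (distance B D / 2)² * ((1 + x)² + y²).
Proof.
  rewrite <- (frame_left B D) at 1. rewrite distance_frame_sqr. unfold Rsqr; ring.
Qed.

Lemma distance_right_frame_sqr (B D : point) (x y : R) :
  (distance D (frame B D x y))² = (distance B D / 2)² * ((1 - x)² + y²).
Proof.
  rewrite <- (frame_right B D) at 1. rewrite distance_frame_sqr. unfold Rsqr; ring.
Qed.

Lemma orient_frame (B D : point) (x y x' y' x'' y'' : R) :
  orient (frame B D x y) (frame B D x' y') (frame B D x'' y'')
  = (distance B D / 2)² * ((x' - x) * (y'' - y) - (y' - y) * (x'' - x)).
Proof.
  rewrite Rsqr_div', distance_sqr. unfold orient, frame, Rsqr; simpl. field.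
Qed.

Lemma orient_base_frame (B D : point) (x y : R) :
  orient B D (frame B D x y) = (distance B D / 2)² * (2 * y).
Proof.
  rewrite Rsqr_div', distance_sqr. unfold orient, frame, Rsqr; simpl. field.
Qed.

(* Sides sharing a vertex force the four triangles [ABC], [BCD], [CDA], [DAB]
   to have the same orientation; [BCD] and [DAB] are on opposite sides of [BD]. *)
Lemma convex_opposite_sides (A B C D : point) :
  convex_quadrilateral A B C D -> orient B D A * orient B D C < 0.
Proof.
  intros (_ & H1 & H2 & _). unfold same_side in *.
  replace (orient A B D) with (orient B D A) in H1 by (unfold orient; ring).
  replace (orient B C D) with (- orient B D C) in H2 by (unfold orient; ring).
  replace (orient B C A) with (orient A B C) in H2 by (unfold orient; ring).
  nra.
Qed.

(** * Acute angles, circles and the longest chord *)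

Lemma acute_sin_cos (t : R) : acute t -> 0 < sin t /\ 0 < cos t.
Proof.
  intros [H0 H1]. split; [apply sin_gt_0 | apply cos_gt_0]; pose proof PI_RGT_0; lra.
Qed.

Lemma cot_pos (t : R) : acute t -> 0 < cot t.
Proof.
  intros H. destruct (acute_sin_cos t H). apply Rdiv_lt_0_compat; assumption.
Qed.

Lemma inv_sin_pos (t : R) : acute t -> 0 < / sin t.
Proof. intros H. apply Rinv_0_lt_compat, (acute_sin_cos t H). Qed.

Lemma inv_sin_sqr (t : R) : acute t -> (/ sin t)² = 1 + (cot t)².
Proof.
  intros H. destruct (acute_sin_cos t H) as [Hs _].
  unfold cot. rewrite Rsqr_div', Rsqr_inv', cos2.
  unfold Rsqr.
  field. lra.
Qed.

Lemma apex_pos (t : R) : acute t -> 0 < apex t.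
Proof.
  intros H. pose proof (cot_pos t H). pose proof (inv_sin_pos t H). unfold apex; lra.
Qed.

Lemma apex_on_circle (t : R) :
  acute t -> 0² + (apex t)² - 1 = 2 * cot t * Rabs (apex t).
Proof.
  intros H. rewrite (Rabs_pos_eq _ (Rlt_le _ _ (apex_pos t H))).
  pose proof (inv_sin_sqr t H). unfold apex, Rsqr in *. nra.
Qed.

(** Inscribed angle theorem. Up to scaling, the vectors from the vertex to [D] and [B] have scalar
    product [N = x² + y² - 1] and cross product of absolute value [2 * Rabs y], so the product of
    their lengths is [S = sqrt (N² + 4 * y²)]. The angle is [t] exactly when [N = S * cos t] and
    [2 * Rabs y = S * sin t]; the quotient of the two is the circle equation, with one arc for each
    sign of [y]. *)
Lemma angle_frame (B D : point) (x y t : R) :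
  B <> D -> y <> 0 -> acute t ->
  (angle D (frame B D x y) B = t <-> x² + y² - 1 = 2 * cot t * Rabs y).
Proof.
  intros HBD Hy Ht.
  pose proof (distance_pos B D HBD) as Hd.
  destruct (acute_sin_cos t Ht) as [Hs Hc].
  pose proof (sin2_cos2 t) as Esc.
  pose proof (Rabs_pos_lt y Hy) as Hay.
  pose proof (Rsqr_abs y) as Eay.
  set (N := x² + y² - 1).
  set (S := sqrt (N² + 4 * y²)).
  assert (HS2 : S² = N² + 4 * y²).
  { apply Rsqr_sqrt. unfold Rsqr; nra. }
  assert (HS : 0 < S).
  { apply sqrt_lt_R0. rewrite Eay. unfold Rsqr; nra. }
  assert (EP : distance D (frame B D x y) * distance B (frame B D x y)
               = (distance B D / 2)² * S).
  { apply Rsqr_inj.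
    - apply Rmult_le_pos; apply distance_nonneg.
    - apply Rmult_le_pos; [apply Rle_0_sqr | lra].
    - rewrite !Rsqr_mult, HS2, distance_left_frame_sqr, distance_right_frame_sqr.
      unfold N, Rsqr; ring. }
  assert (EA : angle D (frame B D x y) B = acos (N / S)).
  { unfold angle. rewrite EP. f_equal.
    match goal with |- ?n / _ = _ => replace n with ((distance B D / 2)² * N) end.
    - field. split; [lra |]. unfold Rsqr; nra.
    - rewrite Rsqr_div', distance_sqr. unfold N, frame, Rsqr; simpl; field. }
  assert (Hb : -1 <= N / S <= 1).
  { assert (Rabs N <= S).
    { rewrite <- (Rabs_pos_eq S) by lra. apply Rsqr_le_abs_0.
      rewrite HS2. pose proof (Rle_0_sqr y); lra. }
    pose proof (Rle_abs N). pose proof (Rle_abs (- N)). rewrite Rabs_Ropp in *.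
    split; [apply (Rmult_le_reg_r S) | apply (Rmult_le_reg_r S)]; try lra;
      unfold Rdiv; rewrite Rmult_assoc, Rinv_l; lra. }
  rewrite EA. unfold cot. split; intros H.
  - assert (E : N = S * cos t).
    { rewrite <- H, cos_acos by exact Hb. field; lra. }
    assert (E2 : S * sin t = 2 * Rabs y).
    { apply Rsqr_inj; try nra. rewrite !Rsqr_mult, <- Eay.
      rewrite E in HS2 at 1. unfold Rsqr in *; nra. }
    apply (Rmult_eq_reg_r (sin t)); [| lra].
    field_simplify; [| lra]. rewrite E. nra.
  - assert (E : N * sin t = 2 * Rabs y * cos t) by (rewrite H; field; lra).
    assert (E2 : S * sin t = 2 * Rabs y).
    { apply Rsqr_inj; try nra. rewrite !Rsqr_mult, <- Eay, HS2.
      assert (N² * (sin t)² = 4 * y² * (cos t)²).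
      { rewrite Eay, <- Rsqr_mult, E. unfold Rsqr; ring. }
      replace (2²) with 4 by (unfold Rsqr; ring).
      rewrite Rmult_plus_distr_r, H0, <- Rmult_plus_distr_l, (Rplus_comm (cos t)²), Esc. ring. }
    replace (N / S) with (cos t).
    + apply acos_cos. destruct Ht. pose proof PI_RGT_0; lra.
    + apply (Rmult_eq_reg_r (S * sin t)); [| nra].
      rewrite E2 at 1. field_simplify; [| lra]. rewrite E. ring.
Qed.

(* [(x, y)] and [(x', -y')] lie on the circles of centres [(0, k)], [(0, -k')]
   and radii [r], [r']; the conclusion is the squared triangle inequality
   through the centres, with its equality case. *)
Lemma chord_bound (k k' r r' x y x' y' : R) :
  0 < k -> 0 < k' -> 0 < r -> 0 < r' ->
  x² + (y - k)² = r² -> x'² + (y' - k')² = r'² ->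
  (x - x')² + (y + y')² <= (k + r + (k' + r'))² /\
  ((x - x')² + (y + y')² = (k + r + (k' + r'))² ->
   x = 0 /\ y = k + r /\ x' = 0 /\ y' = k' + r').
Proof.
  intros Hk Hk' Hr Hr' E E'.
  set (s := y - k) in *. set (s' := y' - k') in *.
  assert (Hs : s <= r) by (unfold Rsqr in E; nra).
  assert (Hs' : s' <= r') by (unfold Rsqr in E'; nra).
  (* Cauchy-Schwarz for the radius vectors, by Lagrange's identity: the defect is the square of
     [x * s' + s * x']. *)
  assert (CS : s * s' - x * x' <= r * r').
  { apply Rsqr_incr_0_var; [| nra].
    rewrite (Rsqr_mult r r'), <- E, <- E'.
    pose proof (Rle_0_sqr (x * s' + s * x')). unfold Rsqr in *; nra. }
  (* The deficit is a sum of three nonnegative terms. Since [k + k'] is positive, its vanishing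
     forces [s = r] and [s' = r'], and then [x] and [x'] vanish by the circle equations. *)
  assert (Ex : (k + r + (k' + r'))² - ((x - x')² + (y + y')²)
    = 2 * (r * r' - (s * s' - x * x'))
      + 2 * (k + k') * (r - s) + 2 * (k + k') * (r' - s')).
  { replace y with (s + k) by (unfold s; ring).
    replace y' with (s' + k') by (unfold s'; ring).
    unfold Rsqr in *; nra. }
  assert (P : 0 <= (k + k') * (r - s)) by (apply Rmult_le_pos; lra).
  assert (P' : 0 <= (k + k') * (r' - s')) by (apply Rmult_le_pos; lra).
  split; [lra |]. intros Eq.
  assert (Q : r - s = 0) by (apply (Rmult_eq_reg_l (k + k')); lra).
  assert (Q' : r' - s' = 0) by (apply (Rmult_eq_reg_l (k + k')); lra).
  assert (s = r) by lra. assert (s' = r') by lra.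
  rewrite H in E. rewrite H0 in E'.
  repeat split; try (apply Rsqr_0_uniq; lra); unfold s, s' in *; lra.
Qed.

Lemma circle_equation (t x y : R) :
  acute t -> x² + y² - 1 = 2 * cot t * y -> x² + (y - cot t)² = (/ sin t)².
Proof.
  intros Ht E. rewrite (inv_sin_sqr t Ht). unfold Rsqr in *; lra.
Qed.

(* [s] is the side of [BD] on which [A] lies. *)
Lemma admissible_frame (B D A C : point) (t1 t2 : R) :
  B <> D -> acute t1 -> acute t2 -> admissible B D t1 t2 A C ->
  exists s x y x' y',
    (s = 1 \/ s = -1) /\
    A = frame B D x (s * y) /\ C = frame B D x' (- s * y') /\
    x² + (y - cot t1)² = (/ sin t1)² /\ x'² + (y' - cot t2)² = (/ sin t2)².
Proof.
  intros HBD H1 H2 (Hc & HA & HC).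
  destruct (frame_surj B D A HBD) as (x & y & ->).
  destruct (frame_surj B D C HBD) as (x' & y' & ->).
  apply convex_opposite_sides in Hc.
  assert (Hyy : y * y' < 0).
  { pose proof (half_distance_sqr_pos B D HBD).
    rewrite !orient_base_frame in Hc.
    set (q := (distance B D / 2)²) in *. nra. }
  assert (y <> 0) by (intros ->; lra).
  assert (y' <> 0) by (intros ->; lra).
  apply angle_frame in HA; try assumption.
  apply angle_frame in HC; try assumption.
  (* The witnesses for the heights are [Rabs y] and [Rabs y'], which rids both circle equations of
     absolute values; the sign goes into [s]. *)
  destruct (Rlt_le_dec 0 y) as [Hy | Hy].
  - exists 1, x, y, x', (- y').
    rewrite Rabs_pos_eq in HA by lra. rewrite Rabs_left in HC by nra.
    repeat split; [now left | f_equal; ring | f_equal; ring | |];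
      apply circle_equation; try assumption. rewrite <- Rsqr_neg; assumption.
  - exists (-1), x, (- y), x', y'.
    rewrite Rabs_left in HA by lra. rewrite Rabs_pos_eq in HC by nra.
    repeat split; [now right | f_equal; ring | f_equal; ring | |];
      apply circle_equation; try assumption. rewrite <- Rsqr_neg; assumption.
Qed.

(** * The extremal kite and its mirror image *)

Lemma kite_convex (B D : point) (a c : R) :
  B <> D -> 0 < a -> 0 < c ->
  convex_quadrilateral (frame B D 0 a) B (frame B D 0 (- c)) D.
Proof.
  intros HBD Ha Hc.
  enough (H : convex_quadrilateral (frame B D 0 a) (frame B D (-1) 0)
                (frame B D 0 (- c)) (frame B D 1 0))
    by (rewrite frame_left, frame_right in H; exact H).
  assert (Hne : forall x y x' y', x <> x' \/ y <> y' -> frame B D x' y' <> frame B D x y).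
  { intros x y x' y' H E. apply (frame_inj B D) in E; [| assumption].
    destruct E; subst; tauto. }
  split.
  - repeat constructor; simpl; intros H; decompose sum H;
      match goal with
      | E : frame _ _ _ _ = _ |- _ => revert E; apply Hne; lra
      | _ => contradiction
      end.
  - pose proof (half_distance_sqr_pos B D HBD) as Hd.
    unfold same_side. rewrite !orient_frame.
    set (q := (distance B D / 2)²) in *.
    repeat split; apply Rmult_lt_0_compat; apply Rmult_lt_0_compat; lra.
Qed.

Lemma kite_admissible (B D : point) (t1 t2 : R) :
  B <> D -> acute t1 -> acute t2 ->
  admissible B D t1 t2 (frame B D 0 (apex t1)) (frame B D 0 (- apex t2)).
Proof.
  intros HBD H1 H2.
  pose proof (apex_pos t1 H1) as P1. pose proof (apex_pos t2 H2) as P2.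
  split; [| split].
  - apply kite_convex; assumption.
  - apply angle_frame; try assumption; [lra | apply apex_on_circle; assumption].
  - apply angle_frame; try assumption; [lra |].
    rewrite Rabs_Ropp, <- Rsqr_neg. apply apex_on_circle; assumption.
Qed.

(** The first clause makes the kite optimal. The second applies to every optimal pair, because the
    kite is itself a competitor. *)
Lemma admissible_bound (B D A C : point) (t1 t2 : R) :
  B <> D -> acute t1 -> acute t2 -> admissible B D t1 t2 A C ->
  let K := frame B D 0 (apex t1) in
  let L := frame B D 0 (- apex t2) in
  distance A C <= distance K L /\
  (distance K L <= distance A C ->
   exists s, (s = 1 \/ s = -1) /\
     A = frame B D 0 (s * apex t1) /\ C = frame B D 0 (- s * apex t2)).
Proof.
  intros HBD H1 H2 H K L.
  destruct (admissible_frame B D A C t1 t2 HBD H1 H2 H)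
    as (s & x & y & x' & y' & Hs & -> & -> & E & E').
  destruct (chord_bound _ _ _ _ _ _ _ _ (cot_pos t1 H1) (cot_pos t2 H2)
              (inv_sin_pos t1 H1) (inv_sin_pos t2 H2) E E') as [Hle Heq].
  fold (apex t1) (apex t2) in Hle, Heq.
  pose proof (half_distance_sqr_pos B D HBD) as Hd.
  assert (EKL : (distance K L)² = (distance B D / 2)² * (apex t1 + apex t2)²).
  { unfold K, L. rewrite distance_frame_sqr. unfold Rsqr; ring. }
  assert (EAC : (distance (frame B D x (s * y)) (frame B D x' (- s * y')))²
                = (distance B D / 2)² * ((x - x')² + (y + y')²)).
  { rewrite distance_frame_sqr. destruct Hs as [-> | ->]; unfold Rsqr; ring. }
  split.
  - apply Rsqr_incr_0; try apply distance_nonneg.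
    rewrite EKL, EAC. apply Rmult_le_compat_l; lra.
  - intros Hge. apply Rsqr_incr_1 in Hge; try apply distance_nonneg.
    rewrite EKL, EAC in Hge. apply Rmult_le_reg_l in Hge; [| assumption].
    destruct (Heq (Rle_antisym _ _ Hle Hge)) as (-> & -> & -> & ->).
    exists s; auto.
Qed.

Lemma optimal_kite (B D A C : point) (t1 t2 : R) :
  B <> D -> acute t1 -> acute t2 -> optimal B D t1 t2 A C ->
  exists s, (s = 1 \/ s = -1) /\
    A = frame B D 0 (s * apex t1) /\ C = frame B D 0 (- s * apex t2).
Proof.
  intros HBD H1 H2 [Hadm Hopt].
  apply (admissible_bound B D A C t1 t2 HBD H1 H2 Hadm).
  apply Hopt, kite_admissible; assumption.
Qed.

Lemma equidistant_frame (B D : point) (y : R) :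
  distance (frame B D 0 y) B = distance (frame B D 0 y) D.
Proof.
  rewrite !(distance_comm (frame B D 0 y)). apply distance_eq.
  rewrite distance_left_frame_sqr, distance_right_frame_sqr.
  unfold Rsqr; ring.
Qed.

(** The map is the identity for [e = 1] and the reflection in the line [BD] for [e = -1]; it carries
    one optimal configuration to another while fixing [B] and [D]. *)
Lemma frame_change_sign_isometry (B D : point) (e : R) :
  B <> D -> e = 1 \/ e = -1 ->
  exists f, isometry f /\ forall x y, f (frame B D x y) = frame B D x (e * y).
Proof.
  intros HBD He.
  pose proof (half_distance_sqr_pos B D HBD) as Hd.
  (* [Y] reads the ordinate off the signed area, so [f] is an explicit function on points: it shifts
     [P] along the normal of [BD] by [(e - 1) * Y P] frame units. *)
  pose (Y := fun P => orient B D P / (2 * (distance B D / 2)²)).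
  assert (HY : forall x y, Y (frame B D x y) = y).
  { intros x y. unfold Y. rewrite orient_base_frame. field.
    intros E; rewrite E in Hd; unfold Rsqr in Hd; lra. }
  pose (f := fun P : point =>
    (fst P - (e - 1) * Y P * ((snd D - snd B) / 2),
     snd P + (e - 1) * Y P * ((fst D - fst B) / 2))).
  assert (Hf : forall x y, f (frame B D x y) = frame B D x (e * y)).
  { intros x y. unfold f. rewrite HY. unfold frame; simpl; f_equal; ring. }
  exists f. split; [| exact Hf].
  intros P Q.
  destruct (frame_surj B D P HBD) as (x & y & ->).
  destruct (frame_surj B D Q HBD) as (x' & y' & ->).
  rewrite !Hf. apply distance_eq. rewrite !distance_frame_sqr.
  destruct He as [-> | ->]; unfold Rsqr; ring.
Qed.

Theorem proposition3p7 (B D : point) (theta1 theta2 : R)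
  (hBD : B <> D) (h1 : acute theta1) (h2 : acute theta2) :
  (exists A C : point, optimal B D theta1 theta2 A C) /\
  (forall A C A' C' : point,
     optimal B D theta1 theta2 A C -> optimal B D theta1 theta2 A' C' ->
     congruent A B C D A' B C' D) /\
  (forall A C : point,
     optimal B D theta1 theta2 A C ->
     distance A B = distance A D /\ distance C B = distance C D).
Proof.
  split; [| split].
  - exists (frame B D 0 (apex theta1)), (frame B D 0 (- apex theta2)).
    split; [apply kite_admissible; assumption |].
    intros A' C' H'. apply admissible_bound; assumption.
  - intros A C A' C' H H'.
    destruct (optimal_kite _ _ _ _ _ _ hBD h1 h2 H) as (s & Hs & -> & ->).
    destruct (optimal_kite _ _ _ _ _ _ hBD h1 h2 H') as (s' & Hs' & -> & ->).
    (* Signs are their own inverses, so [s * s'] turns [s] into [s']. *)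
    destruct (frame_change_sign_isometry B D (s * s') hBD) as (f & Hiso & Hf).
    { destruct Hs as [-> | ->], Hs' as [-> | ->]; lra. }
    assert (Hss : s * s = 1) by (destruct Hs as [-> | ->]; ring).
    exists f. split; [exact Hiso |]. rewrite !Hf. repeat split.
    + f_equal. transitivity (s * s * (s' * apex theta1)); [ring | rewrite Hss; ring].
    + rewrite <- (frame_left B D) at 1. rewrite Hf, Rmult_0_r. apply frame_left.
    + f_equal. transitivity (s * s * (- s' * apex theta2)); [ring | rewrite Hss; ring].
    + rewrite <- (frame_right B D) at 1. rewrite Hf, Rmult_0_r. apply frame_right.
  - intros A C H.
    destruct (optimal_kite _ _ _ _ _ _ hBD h1 h2 H) as (s & _ & -> & ->).
    split; apply equidistant_frame.
Qed.
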